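(* Let $\{A_n\}_{n\geqslant 1}$ be i.i.d. nonnegative random variables with Laplace–Stieltjes transform $\alpha(s)=\mathbb{E}[e^{-sA_1}]$, and let $\{B_n\}_{n\geqslant 1}$ be i.i.d. Erlang distributed with $N$ phases and rate $\mu>0$, independent of $\{A_n\}$. Let $W_1=0$ and $W_{n+1}=\max\{0,\,B_{n+1}-A_n-W_n\}$ for $n\geqslant 1$, and let $C=\inf\{k\geqslant 1: W_{1+k}=0\}$. Define, for $i,j\in\{1,\dots,N\}$, $$p_{ij}=\frac{(-\mu)^{N-j}}{2^i}\sum_{\ell=0}^{N-j}\binom{i+\ell-1}{i-1}\frac{\alpha^{(N-j-\ell)}(\mu)}{(N-j-\ell)!}\left(-\frac{1}{2\mu}\right)^{\ell},\qquad p_{0j}=\frac{(-\mu)^{N-j}}{(N-j)!}\alpha^{(N-j)}(\mu).$$ Let $\mathbf Q=(p_{ij})_{i,j=1}^N$, let $\mathbf q=(p_{01},\dots,p_{0N})$ (a row vector), let $\mathbf I$ be the $N\times N$ identity matrix and $\mathbf e$ the $N\times 1$ vector of ones. Then for every $n\geqslant 1$, $$\mathbb{P}[C=n+1]=\mathbf q\,\mathbf Q^{\,n-1}(\mathbf I-\mathbf Q)\,\mathbf e.$$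
   Context: $\alpha^{(m)}$ denotes the $m$-th derivative of $\alpha$. The numbers $p_{ij}$ are the transition probabilities of the Markov chain $F_n$ = number of remaining exponential preparation phases at the moment the $n$-th waiting time starts (state $0$ corresponding to $W_n=0$). *)

(* Defs.v *)
From HB Require Import structures.
From mathcomp Require Import all_boot all_order all_algebra.
From mathcomp Require Import all_classical all_reals all_analysis.
Set Implicit Arguments. Unset Strict Implicit. Unset Printing Implicit Defensive.
Import Order.TTheory GRing.Theory Num.Theory.
Import numFieldNormedType.Exports.
Local Open Scope classical_set_scope.
Local Open Scope ring_scope.

Definition mutually_independent {d} {T : measurableType d} {R : realType}
  (P : probability T R) {I : eqType} (D : I -> Prop) (X : I -> T -> R) :=
  forall (J : seq I) (E : I -> set R),
    uniq J -> (forall i, i \in J -> D i) ->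
    (forall i, i \in J -> measurable (E i)) ->
    P [set t | forall i, i \in J -> E i (X i t)] =
    (\prod_(i <- J) P (X i @^-1` E i))%E.

Definition erlang_pdf {R : realType} (N : nat) (mu : R) (x : R) : R :=
  mu ^+ N * x ^+ N.-1 * expR (- (mu * x)) / (N.-1)`!%:R.

Definition erlang_distributed {d} {T : measurableType d} {R : realType}
  (P : probability T R) (N : nat) (mu : R) (X : T -> R) :=
  forall E : set R, measurable E ->
    P (X @^-1` E) =
    (\int[lebesgue_measure]_(x in E `&` [set x : R | (0 <= x)%R]) (erlang_pdf N mu x)%:E)%E.

Definition lst {d} {T : measurableType d} {R : realType}
  (P : probability T R) (X : T -> R) (s : R) : R :=
  fine ('E_P[fun t => expR (- (s * X t))])%E.

Definition nderiv {R : realType} (m : nat) (f : R -> R) : R -> R :=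
  derive1n m f.

(** Waiting times: W A B n = W_n for n >= 1 (W 0 is a dummy value 0),
    W_1 = 0, W_{n+1} = max(0, B_{n+1} - A_n - W_n). *)
Fixpoint W {T : Type} {R : realType} (A B : nat -> T -> R) (n : nat) (t : T) : R :=
  match n with
  | 0 => 0
  | 1 => 0
  | (m.+1) as k => Num.max 0 (B k t - A m t - W A B m t)
  end.

Definition C_eq {T : Type} {R : realType} (A B : nat -> T -> R) (m : nat) : set T :=
  [set t | (1 <= m)%N /\ W A B m.+1 t = 0 /\
           forall k, (1 <= k < m)%N -> W A B k.+1 t <> 0].

Definition p_ij {R : realType} (alpha : R -> R) (N : nat) (mu : R) (i j : nat) : R :=
  (- mu) ^+ (N - j) / 2%:R ^+ i *
  \sum_(l < (N - j).+1)
     ('C(i + l - 1, i - 1))%:R * nderiv (N - j - l) alpha mu / ((N - j - l)`!)%:R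
       * (- (2%:R * mu)^-1) ^+ l.

Definition p_0j {R : realType} (alpha : R -> R) (N : nat) (mu : R) (j : nat) : R :=
  (- mu) ^+ (N - j) / ((N - j)`!)%:R * nderiv (N - j) alpha mu.

Definition Qmx {R : realType} (alpha : R -> R) (N : nat) (mu : R) : 'M[R]_N :=
  \matrix_(i < N, j < N) p_ij alpha N mu i.+1 j.+1.

Definition qrow {R : realType} (alpha : R -> R) (N : nat) (mu : R) : 'rV[R]_N :=
  \row_(j < N) p_0j alpha N mu j.+1.

Definition mxpow {R : realType} {N : nat} (M : 'M[R]_N) (k : nat) : 'M[R]_N :=
  iter k (mulmx M) 1%:M.

(* Main.v *)
Require Import Defs.
From HB Require Import structures.
From mathcomp Require Import all_boot all_order all_algebra.
From mathcomp Require Import all_classical all_reals all_analysis.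
From mathcomp Require Import measurable_realfun.
From mathcomp Require Import ring lra.
Set Implicit Arguments. Unset Strict Implicit. Unset Printing Implicit Defensive.
Import Order.TTheory GRing.Theory Num.Theory.
Import numFieldNormedType.Exports.
Local Open Scope classical_set_scope.
Local Open Scope ring_scope.

(** On the event C > n, the waiting time W_(n+1) is a mixture of Erlang laws:
    for f >= 0, E[f(W_(n+1)); C > n] = sum_j w_j E[f(Erlang(j, mu))], where w_j
    is the j-th entry of q Q^(n-1). This is propagated along the recursion.
    Given Y = A_(n+1) + W_(n+1), the overshoot of B_(n+2) above Y has j phases
    with weight e^(-mu Y) (mu Y)^(N-j) / (N-j)!, by the binomial formula applied
    to the Erlang density at x + Y. The binomial formula again splits this weight
    into a convolution of a factor in A and a factor in W, which are independent.
    The factor in A has mean (-mu)^k alpha^(k)(mu) / k!, by differentiation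
    under the integral; the mean of the factor in W is a Gamma integral of
    rate 2 mu, by the induction hypothesis. Taking f = 1 gives
    P(C > n) = q Q^(n-1) e, and the claim is a difference of two such terms. *)

(** * Densities and translations *)

(** The image of Lebesgue measure under a translation gives each interval its length, so uniqueness
    of Lebesgue measure identifies the two. *)
Lemma ge0_integral_translation {R : realType} (y : R) (f : R -> \bar R) :
  measurable_fun [set: R] f -> (forall x, 0 <= f x)%E ->
  (\int[lebesgue_measure]_x f x = \int[lebesgue_measure]_x f (x + y)%R)%E.
Proof.
move=> mf f0.
pose phi : measurableTypeR R -> measurableTypeR R := fun x => x + y.
have mphi : measurable_fun setT phi by exact: measurable_funD.
transitivity (\int[pushforward lebesgue_measure phi]_x f x)%E; last first.
  by rewrite (ge0_integral_pushforward mphi).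
apply: eq_measure_integral => A mA _.
apply: (@lebesgue_measure_unique _ (pushforward lebesgue_measure phi)) => // _ [[a b] ab <-].
rewrite /= /pushforward (_ : phi @^-1` _ = `]a - y, b - y]%classic).
  rewrite !lebesgue_measure_itv /= !lte_fin ltrD2r; case: ifP => // _.
  by rewrite -!EFinB; congr (_%:E); ring.
by apply/seteqP; split=> x /=; rewrite !in_itv /= ltrBlDr lerBrDr.
Qed.

Import HBNNSimple.

(* [lebesgue_measure] lives on [measurableTypeR R], a measurable type distinct
   from the canonical one on [R]: the map [e] bridges the two. *)
Lemma ge0_integral_density d d' (T : measurableType d) (T' : measurableType d')
    (R : realType) (m : {measure set T -> \bar R}) (m' : {measure set T' -> \bar R})
    (e : T' -> T) (D : set T') (g : T' -> R) (f : T -> R) :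
  measurable_fun setT e ->
  measurable D -> measurable_fun setT g -> (forall x, D x -> 0 <= g x) ->
  (forall E, measurable E -> m E = \int[m']_(x in e @^-1` E `&` D) (g x)%:E)%E ->
  measurable_fun setT f -> (forall x, 0 <= f x) ->
  (\int[m]_x (f x)%:E = \int[m']_(x in D) (f (e x) * g x)%:E)%E.
Proof.
move=> me mD mg g0 mE mf f0.
have mfE : measurable_fun setT (EFin \o f) by exact/measurable_EFinP.
have f0E x : (0 <= (EFin \o f) x)%E by rewrite lee_fin.
pose h := nnsfun_approx measurableT mfE.
have hf x : (EFin \o h n) x @[n --> \oo] --> (EFin \o f) x.
  exact: cvg_nnsfun_approx.
(* Both integrals are monotone limits along the same simple functions [h n], so it suffices to
   compare them for each [h n]. *)
transitivity (limn (fun n => \int[m]_x (h n x)%:E)%E).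
  rewrite -monotone_convergence//.
  - by apply: eq_integral => x _; apply/esym/cvg_lim => //; exact: hf.
  - by move=> n; exact/measurable_EFinP.
  - by move=> n x _; rewrite lee_fin.
  - by move=> x _ a b ab; rewrite lee_fin; exact/lefP/nd_nnsfun_approx.
transitivity (limn (fun n => \int[m']_(x in D) (h n (e x) * g x)%:E)%E); last first.
  rewrite -monotone_convergence//.
  - apply: eq_integral => x _; apply/cvg_lim => //.
    under eq_fun do rewrite EFinM.
    by rewrite EFinM; apply: cvgeZr => //; exact: hf.
  - move=> n; apply/measurable_EFinP/measurable_funTS/measurable_funM => //.
    exact: measurableT_comp.
  - by move=> n x Dx; rewrite lee_fin mulr_ge0 ?g0.
  - move=> x Dx a b ab; rewrite lee_fin ler_wpM2r ?g0//.
    exact/lefP/nd_nnsfun_approx.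
congr (limn _); apply/funext => n.
under eq_integral do rewrite fimfunE -fsumEFin//.
rewrite ge0_integral_fsum//; last 2 first.
- by move=> r; exact/measurable_EFinP/measurable_funM.
- by move=> r x _; rewrite nnfun_muleindic_ge0.
(* A simple function is split into its level sets; on each one the identity is the hypothesis
   [mE]. *)
transitivity (\sum_(r \in range (h n)) \int[m']_(x in D) (r * \1_(h n @^-1` [set r]) (e x) * g x)%:E)%E.
  apply: eq_fsbigr => r /set_mem[x _ <-].
  have hx0 : (0 <= (h n x)%:E)%E by rewrite lee_fin.
  under eq_integral do rewrite EFinM.
  rewrite ge0_integralZl//=; last exact/measurable_EFinP.
  under [RHS]eq_integral do rewrite -mulrA EFinM.
  rewrite ge0_integralZl//=; last 2 first.
    apply/measurable_EFinP/measurable_funTS/measurable_funM => //.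
    exact: measurableT_comp.
    by move=> y Dy; rewrite lee_fin mulr_ge0 ?g0.
  congr (_ * _)%E.
  rewrite integral_indic// setIT mE// setIC integral_mkcondr.
  apply: eq_integral => z _ /=; rewrite patchE indicE.
  rewrite -[z \in _]/(e z \in h n @^-1` [set h n x]).
  by case: ifP => _; rewrite ?mul1r ?mul0r.
rewrite -ge0_integral_fsum//.
- by apply: eq_integral => x _; rewrite fsumEFin// fimfunE mulr_fsuml.
- move=> r; apply/measurable_EFinP/measurable_funTS/measurable_funM => //.
  by apply: measurable_funM => //; exact: measurableT_comp.
- move=> r x Dx; rewrite EFinM mule_ge0 ?nnfun_muleindic_ge0//.
  by rewrite lee_fin g0.
Qed.

(** * Independence of disjoint blocks *)

(** A pi-system generating the sigma-algebra of the [X j] with [j] in [J]. The family [E] is total,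
    so that intersections are taken coordinate by coordinate. *)
Definition cylinders {T I : Type} {R : realType} (X : I -> T -> R) (J : {pred I}) :
    set (set T) :=
  [set S | exists2 E : I -> set R, (forall i, measurable (E i)) &
           S = [set t | forall i, i \in J -> E i (X i t)]].

Lemma cylinders_setI T I (R : realType) (X : I -> T -> R) (J : {pred I}) :
  setI_closed (cylinders X J).
Proof.
move=> _ _ [E mE ->] [F mF ->]; exists (fun i => E i `&` F i).
  by move=> i; exact: measurableI.
apply/seteqP; split => t /= => [[EX FX] i iJ|EFX]; first by split; auto.
by split => i /EFX[].
Qed.

Lemma cylinders_preimage T (I : eqType) (R : realType) (X : I -> T -> R)
    (J : seq I) i (F : set R) :
  i \in J -> measurable F -> cylinders X (mem J) (X i @^-1` F).
Proof.
move=> iJ mF; exists (fun k => if k == i then F else setT) => [k|].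
  by case: ifP.
apply/seteqP; split => [t /= FX k _|t /= /(_ _ iJ)]; last by rewrite eqxx.
by case: eqP => [->|].
Qed.

Section independence_of_blocks.
Context d (T : measurableType d) (R : realType) (P : probability T R).
Context (I : eqType) (D : I -> Prop) (X : I -> T -> R) (J : seq I) (i : I).
Hypothesis indepX : mutually_independent P D X.
Hypothesis mX : forall j, D j -> measurable_fun setT (X j).
Hypotheses (uJ : uniq J) (DJ : forall j, j \in J -> D j).
Hypotheses (Di : D i) (iJ : i \notin J).

Lemma cylinders_measurable : cylinders X (mem J) `<=` measurable.
Proof.
move=> _ [E mE ->].
rewrite (_ : [set _ | _] = \big[setI/setT]_(j <- J) (X j @^-1` E j)).
  rewrite big_seq; apply: bigsetI_measurable => k kJ.
  by rewrite -[_ @^-1` _]setTI; apply: mX => //; exact: DJ.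
elim: J => [|k s IH]; first by rewrite big_nil; apply/seteqP; split.
rewrite big_cons -IH; apply/seteqP; split => [t /= EX|t /= [Ek EX] l].
  by split; [apply: EX; rewrite mem_head|move=> l ls; apply: EX; rewrite inE ls orbT].
by rewrite inE => /predU1P[->//|]; exact: EX.
Qed.

(** As functions of [S], both sides are finite measures. They agree on cylinders by mutual
    independence, hence on the generated sigma-algebra. *)
Lemma sigma_cylinders_indep (S : set T) (F : set R) :
  <<s cylinders X (mem J) >> S -> measurable F ->
  (P (S `&` X i @^-1` F) = P S * P (X i @^-1` F))%E.
Proof.
move=> GS mF.
have mXF : measurable (X i @^-1` F) by rewrite -[_ @^-1` _]setTI; exact: mX.
have PF : P (X i @^-1` F) \is a fin_num by exact: fin_num_measure.
pose c : {nonneg R} := NngNum (fine_ge0 (measure_ge0 P (X i @^-1` F))).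
rewrite -[RHS]/(P S * P (X i @^-1` F))%E muleC -(fineK PF).
apply: (@g_sigma_algebra_measure_unique _ _ _ (cylinders X (mem J)) cylinders_measurable
  (fun=> setT) _ _ (mrestr P mXF) (mscale c P)) => //.
- by move=> _; exists (fun=> setT) => //; apply/seteqP; split.
- by apply/seteqP; split => // t _; exists 0%N.
- exact: cylinders_setI.
- move=> _ [E mE ->]; rewrite /= /mscale /= (fineK PF) /mrestr.
  (* Placing [F] at coordinate [i], which lies outside [J], turns the intersection into one event
     over [i :: J]. *)
  pose E' k := if k == i then F else E k.
  have mE' k : measurable (E' k) by rewrite /E'; case: ifP.
  have E'J k : k \in J -> E' k = E k.
    by rewrite /E'; case: eqP => // ->; rewrite (negPf iJ).
  transitivity (P [set t | forall k, k \in i :: J -> E' k (X k t)]).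
    congr (P _); apply/seteqP; split => t /=.
      move=> [EX FX] k; rewrite inE => /predU1P[->|kJ]; first by rewrite /E' eqxx.
      by rewrite E'J //; exact: EX.
    move=> EX; split; last by have := EX i (mem_head _ _); rewrite /E' eqxx.
    by move=> k kJ; rewrite -E'J //; apply: EX; rewrite inE kJ orbT.
  rewrite indepX//=; last 2 first.
    by rewrite iJ.
    by move=> k; rewrite inE => /predU1P[->//|]; exact: DJ.
  rewrite big_cons {1}/E' eqxx; congr (_ * _)%E.
  rewrite indepX//.
  by rewrite !big_seq; apply: eq_bigr => k /E'J ->.
- move=> _; rewrite /= /mrestr setTI.
  by rewrite (le_lt_trans (probability_le1 P mXF)) ?ltry.
Qed.

End independence_of_blocks.

Section freezing.
Context d (T : measurableType d) (R : realType) (P : probability T R).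
Context (G : set (set T)) (Z : {RV P >-> R}).
Hypothesis Gm : G `<=` measurable.
Hypothesis indepZ : forall S F, <<s G >> S -> measurable F ->
  (P (S `&` Z @^-1` F) = P S * P (Z @^-1` F))%E.
Local Notation TG := (g_sigma_algebraType G).

Lemma sigma_sub_measurable : <<s G >> `<=` measurable.
Proof. exact: (smallest_sub (@sigma_algebra_measurable _ T) Gm). Qed.

(* Freezing: [Z] may be integrated out first when it is independent of [G]. *)
Lemma ge0_integral_freezing (h : TG * R -> \bar R) :
  measurable_fun setT h -> (forall x, 0 <= h x)%E ->
  (\int[P]_t h (t, Z t) = \int[P]_t \int[distribution P Z]_z h (t, z))%E.
Proof.
move=> mh h0.
(* The identity, seen as a map to the coarser measurable space: by [indepZ] the joint law of [e] and
   [Z] is the product of their laws, and Tonelli applies. *)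
pose e : T -> TG := id.
have me : measurable_fun setT e.
  by move=> _ S mS; rewrite setTI; exact: sigma_sub_measurable.
pose emix := isMeasurableFun.Build _ _ _ _ _ me.
pose e' : {mfun T >-> TG} := HB.pack e emix.
pose p t := (e t, Z t).
have mp : measurable_fun setT p by exact: measurable_fun_pair.
pose pmix := isMeasurableFun.Build _ _ _ _ _ mp.
pose p' : {mfun T >-> (TG * R)%type} := HB.pack p pmix.
transitivity (\int[distribution P p']_x h x)%E.
  by rewrite ge0_integral_distribution.
transitivity (\int[(distribution P e' \x distribution P Z)%E]_x h x)%E.
  apply: eq_measure_integral => A mA _; apply/esym.
  apply: product_measure_unique => [S F mS mF|]; last exact: mA.
  exact: indepZ.
rewrite (@fubini_tonelli1 _ _ _ _ _ (distribution P e') (distribution P Z) h mh h0).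
rewrite ge0_integral_distribution//.
- exact: measurable_fun_fubini_tonelli_F.
- by move=> y; exact: integral_ge0.
Qed.

End freezing.

(** * Poisson weights *)

(* For [x >= 0], the probability that a Poisson process of rate [mu] has [k]
   points in [[0, x]]. *)
Definition pois {R : realType} (mu : R) (k : nat) (x : R) : R :=
  expR (- (mu * x)) * (mu * x) ^+ k / k`!%:R.

Section poisson_weights.
Context {R : realType}.
Implicit Types (mu x y : R) (k l m : nat).

Lemma factr_neq0 k : k`!%:R != 0 :> R.
Proof. by rewrite pnatr_eq0 -lt0n fact_gt0. Qed.

Lemma pois_ge0 mu k x : 0 <= mu -> 0 <= x -> 0 <= pois mu k x.
Proof.
by move=> mu0 x0; rewrite /pois divr_ge0// mulr_ge0 ?expR_ge0 ?exprn_ge0 ?mulr_ge0.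
Qed.

Lemma erlang_pdf_pois mu k x : erlang_pdf k.+1 mu x = mu * pois mu k x.
Proof. by rewrite /erlang_pdf /pois /= exprMn exprS; ring. Qed.

(** The binomial formula; the points in an interval of length [x + y] are split between its two
    pieces. *)
Lemma poisD mu m x y :
  pois mu m (x + y) = \sum_(l < m.+1) pois mu (m - l) x * pois mu l y.
Proof.
rewrite /pois mulrDr opprD expRD exprDn mulr_sumr mulr_suml.
apply: eq_bigr => l _; have lm : (l <= m)%N by rewrite -ltnS.
have /(congr1 (fun n => n%:R : R)) := bin_fact lm; rewrite !natrM => /= <-.
rewrite -mulr_natr; field.
by rewrite !factr_neq0 pnatr_eq0 -lt0n bin_gt0 lm.
Qed.

(** Two independent processes of rate [mu] merge into one of rate [2 * mu], each point coming from
    either with probability 1/2. This is the origin of the binomials and powers of 2 in [p_ij]. *)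
Lemma poisM mu k l x :
  pois mu k x * pois mu l x =
  'C(k + l, k)%:R / 2 ^+ (k + l) * pois (2 * mu) (k + l) x.
Proof.
have kl : (k <= k + l)%N by rewrite leq_addr.
have := bin_fact kl; rewrite addKn => /(congr1 (fun n => n%:R : R)).
rewrite !natrM /pois => <-.
have -> : expR (- (2 * mu * x)) = expR (- (mu * x)) * expR (- (mu * x)).
  by rewrite -expRD; congr expR; ring.
rewrite -(mulrA 2) (exprMn _ 2) (exprD (mu * x)); field.
by rewrite !factr_neq0 pnatr_eq0 -lt0n bin_gt0 kl expf_neq0.
Qed.

Lemma pois0 mu k : pois mu k 0 = (k == 0)%:R.
Proof.
rewrite /pois mulr0 oppr0 expR0 mul1r expr0n.
by case: k => [|k]; rewrite ?mul0r // fact0 divr1.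
Qed.

(** The forward equations of the Poisson process; their right-hand sides telescope when summed over
    [k]. *)
Lemma is_derive_pois mu k x :
  is_derive x 1 (pois mu k)
    (mu * ((if k is k'.+1 then pois mu k' x else 0) - pois mu k x)).
Proof.
rewrite /pois.
have H : is_derive x 1 (fun z => mu * z) mu.
  by apply: is_derive_eq; rewrite scaler1.
have E : is_derive x 1 (fun z => expR (- (mu * z))) (- mu * expR (- (mu * x))).
  have := @is_derive1_comp R expR (fun z => - (mu * z)) x (expR (- (mu * x))) (- mu).
  by move=> /(_ _ _); rewrite mulrC; apply.
case: k => [|k].
  rewrite (_ : (fun z => _) = fun z => expR (- (mu * z))).
    by rewrite expr0 fact0 divr1 mulr1 sub0r mulrN -mulNr.
  by apply/funext => z; rewrite expr0 fact0 divr1 mulr1.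
have X := is_deriveX k.+1 H.
have EX := is_deriveM E X.
have DX := is_deriveZ (k.+1`!%:R^-1) EX.
rewrite (_ : (fun z => _) =
    k.+1`!%:R^-1 \*: ((fun z => expR (- (mu * z))) * (fun z => mu * z) ^+ k.+1)).
  apply: is_derive_eq.
  rewrite /GRing.scale /= fctE factS natrM exprS; field.
  by rewrite factr_neq0 /= nat1r pnatr_eq0.
by apply/funext => z; rewrite /GRing.scale /= !fctE mulrC.
Qed.

Lemma continuous_pois mu k : continuous (pois mu k).
Proof.
move=> x; apply/differentiable_continuous/derivable1_diffP.
exact: (@ex_derive _ _ _ _ _ _ _ (is_derive_pois mu k x)).
Qed.

Lemma measurable_pois mu k : measurable_fun setT (pois mu k).
Proof. by apply: continuous_measurable_fun; exact: continuous_pois. Qed.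

(** The power over the factorial is one term of the exponential series at [mu * x]. *)
Lemma pois_le1 mu k x : 0 <= mu -> 0 <= x -> pois mu k x <= 1.
Proof.
move=> mu0 x0; rewrite /pois expRN -mulrA ler_pdivrMl ?expR_gt0// mulr1.
have y0 : 0 <= mu * x by rewrite mulr_ge0.
case: k => [|k]; first by rewrite expr0 fact0 divr1 (le_trans _ (expR_ge1Dx _)) ?lerDl.
by apply: le_trans (expR_ge1Dxn k y0); rewrite lerDr.
Qed.

Lemma pois_cvg0 mu k : 0 < mu -> pois mu k x @[x --> +oo%R] --> 0.
Proof.
move=> mu0; apply: (@squeeze_cvgr _ _ _ _ (cst 0) (fun x => k.+1%:R / mu * x^-1)).
- near=> x.
  have x0 : 0 < x by near: x; exact: nbhs_pinfty_gt.
  (* Trading one factor [x] for the next weight, which is at most 1, exhibits decay of order 1/x. *)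
  have -> : pois mu k x = k.+1%:R / mu * x^-1 * pois mu k.+1 x.
    rewrite /pois factS natrM exprS; field.
    by rewrite factr_neq0 nat1r pnatr_eq0 !gt_eqF.
  have c0 : 0 <= k.+1%:R / mu * x^-1 by rewrite !divr_ge0 ?ltW.
  rewrite /=; apply/andP; split; first by apply: mulr_ge0 => //; apply: pois_ge0; exact: ltW.
  by apply: ler_piMr => //; apply: pois_le1; exact: ltW.
- exact: cvg_cst.
- rewrite -[X in _ --> X](mulr0 (k.+1%:R / mu)); apply: cvgMr.
  by apply/gtr0_cvgV0; [exact: nbhs_pinfty_gt|exact: cvg_id].
Unshelve. all: by end_near. Qed.

Lemma integral_pois mu k : 0 < mu ->
  (\int[lebesgue_measure]_(x in `]0%R, +oo[) (pois mu k x)%:E = (mu^-1)%:E)%E.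
Proof.
move=> mu0; rewrite integral_itv_obnd_cbnd; last first.
  by apply/measurable_EFinP/measurable_funTS; exact: measurable_pois.
(* By telescoping, the derivatives of the first [k.+1] weights sum to [- mu * pois mu k], so [F] is
   an antiderivative. It is [- mu^-1] at 0 and tends to 0 at infinity. *)
pose F (x : R) := - mu^-1 * \sum_(l < k.+1) pois mu l x.
have dF (x : R) : is_derive x 1 F (pois mu k x).
  have D := is_deriveZ (- mu^-1) (is_derive_sum (fun l : 'I_k.+1 => is_derive_pois mu l x)).
  have -> : F = - mu^-1 \*: \sum_(l < k.+1) pois mu l.
    by apply/funext => z; rewrite /F /= /GRing.scale /= fct_sumE.
  apply: is_derive_eq; rewrite -mulr_sumr /GRing.scale /= mulrA mulNr mulVf ?gt_eqF//.
  rewrite mulN1r sumrB opprB big_ord_recr /= big_ord_recl /= add0r.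
  by under [X in _ - X]eq_bigr do rewrite /bump /= ; rewrite addrAC subrr add0r.
have F0 : F 0 = - mu^-1.
  rewrite /F big_ord_recl pois0 big1 => [|l _]; last by rewrite pois0.
  by rewrite addr0 mulr1.
rewrite (@ge0_continuous_FTC2y _ _ F 0 0).
- by rewrite F0 EFinN oppeK add0e.
- by move=> x x0; apply: pois_ge0 => //; exact: ltW.
- by apply: continuous_subspaceT => x; exact: continuous_pois.
- have -> : 0 = - mu^-1 * \sum_(l < k.+1) 0 :> R by rewrite big1 ?mulr0.
  apply: cvgMr; apply: cvg_big => [|l _]; last exact: pois_cvg0.
  exact: add_continuous.
- by move=> x _; exact: (@ex_derive _ _ _ _ _ _ _ (dF x)).
- apply: cvg_at_right_filter; apply: differentiable_continuous.
  by apply/derivable1_diffP; exact: (@ex_derive _ _ _ _ _ _ _ (dF 0)).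
- by move=> x _; rewrite derive1E (@derive_val _ _ _ _ _ _ _ (dF x)).
Qed.

End poisson_weights.

(** * Derivatives of the Laplace-Stieltjes transform *)

Section lst_derivatives.
Context d (T : measurableType d) (R : realType) (P : probability T R).
Context (X : {RV P >-> R}).
Hypothesis X0 : forall t, 0 <= X t.

(** The [k]-th derivative in [s] of [expR (- (s * X t))]. *)
Let f (k : nat) (s : R) (t : T) : R := (- X t) ^+ k * expR (- (s * X t)).

Let f_pois k (s : R) t : s != 0 -> f k s t = k`!%:R / (- s) ^+ k * pois s k (X t).
Proof.
move=> s0; rewrite /f /pois.
have -> : (s * X t) ^+ k = (- s) ^+ k * (- X t) ^+ k by rewrite -exprMn mulrNN.
by field; rewrite factr_neq0 expf_neq0// oppr_eq0.
Qed.

Let measurable_f k (s : R) : measurable_fun setT (f k s).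
Proof.
apply: measurable_funM.
  by apply: measurable_funX; exact: measurableT_comp.
by apply: measurableT_comp => //; apply: measurableT_comp => //; exact: measurable_funM.
Qed.

(** A bound uniform in [t] and in [s >= c], which serves as the dominating constant for
    differentiation under the integral. *)
Let f_bound k (c s : R) t : 0 < c -> c <= s -> `|f k s t| <= k`!%:R / c ^+ k.
Proof.
move=> c0 cs; have s0 : 0 < s by exact: lt_le_trans cs.
rewrite f_pois ?gt_eqF// normrM normf_div normrX normrN (gtr0_norm s0) normr_nat.
rewrite (ger0_norm (pois_ge0 _ (ltW s0) (X0 t))).
apply: (@le_trans _ _ (k`!%:R / s ^+ k)).
  apply: ler_piMr; last by apply: pois_le1 => //; exact: ltW.
  by rewrite divr_ge0// exprn_ge0// ltW.
by rewrite ler_wpM2l// lef_pV2 ?posrE ?exprn_gt0// lerXn2r// nnegrE ltW.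
Qed.

Let integrable_f k (s : R) : 0 < s -> P.-integrable setT (EFin \o f k s).
Proof.
move=> s0; apply: measurable_bounded_integrable => //.
  by rewrite (le_lt_trans (probability_le1 P measurableT)) ?ltry.
exists (k`!%:R / s ^+ k); split; first exact: num_real.
by move=> M /ltW kM t _ /=; apply: le_trans kM; exact: f_bound.
Qed.

Let derive_f k (s : R) t : is_derive s 1 (f k ^~ t) (f k.+1 s t).
Proof.
have H : is_derive s 1 (fun z => X t * z) (X t).
  by apply: is_derive_eq; rewrite scaler1.
have E : is_derive s 1 (fun z => expR (- (X t * z))) (expR (- (X t * s)) * - X t).
  have := @is_derive1_comp R expR (fun z => - (X t * z)) s (expR (- (X t * s))) (- X t).
  by move=> /(_ _ _); apply.
have D := is_deriveZ ((- X t) ^+ k) E.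
rewrite (_ : f k ^~ t = (- X t) ^+ k \*: (fun z => expR (- (X t * z)))).
  by apply: is_derive_eq; rewrite /f exprS /GRing.scale /= (mulrC s); ring.
by apply/funext => z; rewrite /f /= (mulrC z).
Qed.

Lemma nderiv_lst k (s : R) : 0 < s ->
  nderiv k (lst P X) s = (\int[P]_t ((- X t) ^+ k * expR (- (s * X t))))%R.
Proof.
rewrite -/(f k s) /nderiv; elim: k s => [|k IH] s s0.
  rewrite derive1n0 /lst unlock /Rintegral; congr fine.
  by apply: eq_integral => t _; rewrite /f expr0 mul1r.
rewrite derive1nS derive1E.
(* The induction hypothesis covers positive arguments only; a neighbourhood of [s] is enough for the
   derivative. *)
transitivity ('D_1 (fun s' => (\int[P]_t f k s' t)%R) s).
  apply: near_eq_derive => //; near=> s'; apply: IH.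
  by near: s'; exact: lt_nbhsr.
rewrite -derive1E.
(* Domination is needed on an open interval around [s] bounded away from 0; the interval from
   [s / 2] to [2 * s] is chosen. *)
have c0 : 0 < s / 2 by rewrite divr_gt0.
have sI x : x \in `]s / 2, (2 * s)[ -> s / 2 <= x.
  by rewrite in_itv /= => /andP[/ltW].
rewrite (@differentiation_under_integral R _ T P (f k) setT measurableT s (s / 2) (2 * s)
   _ _ _ (fun=> k.+1`!%:R / (s / 2) ^+ k.+1)) //=.
- apply: eq_Rintegral => t _.
  by rewrite partial1of2E (@derive_val _ _ _ _ _ _ _ (derive_f k s t)).
- by rewrite in_itv /=; apply/andP; split; lra.
- by move=> x /sI xs; apply: integrable_f; exact: lt_le_trans xs.
- by move=> _; apply: divr_ge0 => //; apply: exprn_ge0; exact: ltW.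
- by move=> *; exact: finite_measure_integrable_cst.
- move=> x t /sI xs _.
  by rewrite partial1of2E (@derive_val _ _ _ _ _ _ _ (derive_f k x t)) f_bound.
Unshelve. all: by end_near. Qed.

Lemma integral_pois_lst (mu : R) k : 0 < mu ->
  (\int[P]_t (pois mu k (X t))%:E =
   ((- mu) ^+ k / k`!%:R * nderiv k (lst P X) mu)%:E)%E.
Proof.
move=> mu0.
rewrite nderiv_lst// -RintegralZl// -/(f k mu); last exact: integrable_f.
rewrite /Rintegral fineK.
  apply: eq_integral => t _; rewrite -/(f k mu t) f_pois ?gt_eqF//.
  congr _%:E; field.
  by rewrite factr_neq0 expf_neq0// oppr_eq0 gt_eqF.
apply: integrable_fin_num => //.
under eq_fun do rewrite EFinM.
by apply: integrableZl => //; exact: integrable_f.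
Qed.

End lst_derivatives.

(** * Overshoot of an Erlang variable over an independent level *)

Section independent_erlang.
Context d (T : measurableType d) (R : realType) (P : probability T R).
Context (G : set (set T)) (Z : {RV P >-> R}).
Hypothesis Gm : G `<=` measurable.
Hypothesis indepZ : forall S F, <<s G >> S -> measurable F ->
  (P (S `&` Z @^-1` F) = P S * P (Z @^-1` F))%E.
Local Notation TG := (g_sigma_algebraType G).

Lemma measurable_fun_sigma_sub d' (U : measurableType d') (u : T -> U) :
  measurable_fun (setT : set TG) u -> measurable_fun (setT : set T) u.
Proof.
move=> mu _ S mS; rewrite setTI; apply: (sigma_sub_measurable Gm).
by have := mu measurableT S mS; rewrite setTI.
Qed.

Lemma ge0_integral_indepM (u : T -> R) (g : R -> R) :
  measurable_fun (setT : set TG) u -> (forall t, 0 <= u t) ->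
  measurable_fun setT g -> (forall x, 0 <= g x) ->
  (\int[P]_t (u t * g (Z t))%:E = \int[P]_t (u t)%:E * \int[P]_t (g (Z t))%:E)%E.
Proof.
move=> mu u0 mg g0.
have mgE : measurable_fun setT (EFin \o g) by exact/measurable_EFinP.
pose h (x : TG * R) := (u x.1 * g x.2)%:E.
have mh : measurable_fun setT h.
  by apply/measurable_EFinP; apply: measurable_funM; apply: measurableT_comp.
have h0 x : (0 <= h x)%E by rewrite lee_fin mulr_ge0.
rewrite (ge0_integral_freezing Gm indepZ mh h0) /h /=.
rewrite -ge0_integralZr//=.
- apply: eq_integral => t _.
  under eq_integral do rewrite EFinM.
  rewrite ge0_integralZl//=.
  + by congr (_ * _)%E; rewrite ge0_integral_distribution.
  + by move=> x _; rewrite lee_fin.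
  + by rewrite lee_fin.
- by apply/measurable_EFinP; exact: measurable_fun_sigma_sub.
- by move=> t _; rewrite lee_fin.
- by apply: integral_ge0 => t _; rewrite lee_fin.
Qed.

Variables (N : nat) (mu : R).
Hypothesis mu0 : 0 < mu.
Hypothesis erlangZ : erlang_distributed P N.+1 mu Z.

Lemma erlang_pdf_ge0 k x : 0 <= x -> 0 <= erlang_pdf k.+1 mu x.
Proof.
by move=> x0; rewrite erlang_pdf_pois; apply: mulr_ge0; [|apply: pois_ge0 => //]; exact: ltW.
Qed.

Lemma measurable_erlang_pdf k : measurable_fun setT (erlang_pdf k.+1 mu).
Proof.
rewrite (_ : erlang_pdf k.+1 mu = fun x => mu * pois mu k x).
  by apply: measurable_funM => //; exact: measurable_pois.
by apply/funext => x; exact: erlang_pdf_pois.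
Qed.

(* Memorylessness in Erlang form: given that a sum of [N.+1] phases exceeds
   [y], its overshoot has [j.+1] phases with weight [pois mu (N - j) y]. *)
Lemma erlang_pdfD x y :
  erlang_pdf N.+1 mu (x + y) =
  \sum_(j < N.+1) pois mu (N - j) y * erlang_pdf j.+1 mu x.
Proof.
rewrite erlang_pdf_pois addrC poisD mulr_sumr; apply: eq_bigr => j _.
by rewrite erlang_pdf_pois mulrCA.
Qed.

(** Substitute [z = x + y] in the integral against the Erlang density, then expand that density with
    [erlang_pdfD]. *)
Lemma integral_erlang_overshoot (y : R) (f : R -> R) :
  0 <= y -> measurable_fun setT f -> (forall x, 0 <= f x) ->
  (\int[distribution P Z]_z (\1_[set x : R | (0 < x)%R] (z - y) * f (z - y))%:E =
   \sum_(j < N.+1) (pois mu (N - j) y)%:E *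
      \int[lebesgue_measure]_(x in `]0%R, +oo[) (f x * erlang_pdf j.+1 mu x)%:E)%E.
Proof.
move=> y0 mf f0.
have mpos : measurable [set x : R | 0 < x].
  rewrite (_ : [set x | _] = `]0, +oo[%classic) //.
  by apply/seteqP; split=> x /=; rewrite in_itv /= andbT.
have mnneg : measurable [set x : R | 0 <= x].
  rewrite (_ : [set x | _] = `[0, +oo[%classic) //.
  by apply/seteqP; split=> x /=; rewrite in_itv /= andbT.
pose g0 (x : R) : R := \1_[set x : R | (0 < x)] x * f x.
have mg0 : measurable_fun setT g0 by apply: measurable_funM.
have g00 x : 0 <= g0 x by rewrite mulr_ge0.
have mg0y : measurable_fun setT (fun z : R => g0 (z - y)).
  by apply: measurableT_comp => //; exact: measurable_funB.
transitivity (\int[lebesgue_measure]_(z in [set x : R | (0 <= x)%R])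
    (g0 (z - y)%R * erlang_pdf N.+1 mu z)%:E)%E.
  pose e : measurableTypeR R -> R := id.
  apply: (ge0_integral_density (e := e) _ mnneg (measurable_erlang_pdf N) _ _ mg0y) => //.
    by move=> _ S mS; rewrite setTI.
  by move=> x; exact: erlang_pdf_ge0.
(* Since [y >= 0], an overshoot forces [z > 0]. The integral thus extends to the whole line, where
   translation is available. *)
have g0neg z : z <= 0 -> g0 (z - y) = 0.
  move=> z0; rewrite /g0 indicE memNset ?mul0r//= => /lt_geF.
  by rewrite subr_le0 (le_trans z0).
transitivity (\int[lebesgue_measure]_z (g0 (z - y)%R * erlang_pdf N.+1 mu z)%:E)%E.
  rewrite integral_mkcond; apply: eq_integral => z _; rewrite patchE.
  case: ifPn => // /negP zn; rewrite g0neg ?mul0r//.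
  by rewrite leNgt; apply/negP => z0; apply: zn; rewrite inE /= ltW.
rewrite (@ge0_integral_translation _ y); last 2 first.
- apply/measurable_EFinP/measurable_funM => //; exact: measurable_erlang_pdf.
- move=> z; rewrite lee_fin; have [z0|z0] := leP z 0.
    by rewrite g0neg ?mul0r.
  by rewrite mulr_ge0// erlang_pdf_ge0 ?ltW.
transitivity (\int[lebesgue_measure]_(x in `]0%R, +oo[)
    \sum_(j < N.+1) (pois mu (N - j) y * (f x * erlang_pdf j.+1 mu x))%:E)%E.
  rewrite [RHS]integral_mkcond; apply: eq_integral => x _; rewrite patchE addrK /g0 indicE.
  have -> : (x \in `]0, +oo[%classic) = (0 < x) by rewrite mem_setE in_itv /= andbT.
  have -> : (x \in [set z : R | 0 < z]) = (0 < x) by apply/idP/idP; rewrite inE.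
  case: ifPn => x0; last by rewrite !mul0r.
  rewrite mul1r erlang_pdfD mulr_sumr sumEFin; congr _%:E.
  by apply: eq_bigr => j _; rewrite mulrCA.
have p0 (j : 'I_N.+1) : 0 <= pois mu (N - j) y by apply: pois_ge0 => //; exact: ltW.
have mfe (j : 'I_N.+1) D : measurable_fun D (fun x => f x * erlang_pdf j.+1 mu x).
  by apply: measurable_funTS; apply: measurable_funM => //; exact: measurable_erlang_pdf.
have fe0 (j : 'I_N.+1) (x : R) : `]0, +oo[%classic x -> 0 <= f x * erlang_pdf j.+1 mu x.
  by rewrite /= in_itv /= andbT => x0; rewrite mulr_ge0// erlang_pdf_ge0 ?ltW.
rewrite ge0_integral_sum//.
- apply: eq_bigr => j _; under eq_integral do rewrite EFinM.
  rewrite ge0_integralZl//=.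
  + by apply/measurable_EFinP; exact: mfe.
  + by move=> x x0; rewrite lee_fin; exact: fe0.
  + by rewrite lee_fin.
- by move=> j; apply/measurable_EFinP; apply: measurable_funM => //; exact: mfe.
- by move=> j x x0; rewrite lee_fin mulr_ge0// fe0.
Qed.

(** Freezing [D] and the level [Y], both determined by [G], reduces the claim to a deterministic
    level. *)
Lemma integral_erlang_overshoot_indep (D : set T) (Y : T -> R) (f : R -> R) :
  <<s G >> D -> measurable_fun (setT : set TG) Y -> (forall t, 0 <= Y t) ->
  measurable_fun setT f -> (forall x, 0 <= f x) ->
  (\int[P]_t (\1_(D `&` [set t | (0 < Z t - Y t)%R]) t * f (Z t - Y t)%R)%:E =
   \sum_(j < N.+1) \int[P]_t (\1_D t * pois mu (N - j) (Y t))%:E *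
      \int[lebesgue_measure]_(x in `]0%R, +oo[) (f x * erlang_pdf j.+1 mu x)%:E)%E.
Proof.
move=> GD mY Y0 mf f0.
have mpos : measurable [set x : R | 0 < x].
  rewrite (_ : [set x | _] = `]0, +oo[%classic) //.
  by apply/seteqP; split=> x /=; rewrite in_itv /= andbT.
pose g0 (x : R) : R := \1_[set x : R | (0 < x)] x * f x.
have mg0 : measurable_fun setT g0 by apply: measurable_funM.
have g00 x : 0 <= g0 x by rewrite mulr_ge0.
have mD : measurable D by exact: (sigma_sub_measurable Gm).
have mYT := measurable_fun_sigma_sub mY.
have mDG : measurable_fun (setT : set TG) (\1_D : TG -> R).
  exact: (@measurable_indic _ TG).
pose h (x : TG * R) := (\1_D (x.1 : T) * g0 (x.2 - Y x.1))%:E.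
have mh : measurable_fun setT h.
  apply/measurable_EFinP; apply: measurable_funM.
    exact: (measurableT_comp mDG measurable_fst).
  apply: measurableT_comp => //; apply: measurable_funB => //.
  exact: measurableT_comp.
have h0 x : (0 <= h x)%E by rewrite lee_fin mulr_ge0.
transitivity (\int[P]_t h (t, Z t))%E.
  apply: eq_integral => t _; congr _%:E; rewrite /h /g0 /= mulrA; congr (_ * _).
  by rewrite indicI.
rewrite (ge0_integral_freezing Gm indepZ mh h0).
pose K (j : 'I_N.+1) := (\int[lebesgue_measure]_(x in `]0%R, +oo[) (f x * erlang_pdf j.+1 mu x)%:E)%E.
have K0 j : (0 <= K j)%E.
  apply: integral_ge0 => x /=; rewrite in_itv /= andbT => x0.
  by rewrite lee_fin mulr_ge0// erlang_pdf_ge0 ?ltW.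
have p0 (j : 'I_N.+1) t : 0 <= \1_D t * pois mu (N - j) (Y t).
  by rewrite mulr_ge0//; apply: pois_ge0 => //; exact: ltW.
have mp (j : 'I_N.+1) : measurable_fun setT (fun t => \1_D t * pois mu (N - j) (Y t)).
  by apply: measurable_funM => //; apply: measurableT_comp => //; exact: measurable_pois.
transitivity (\int[P]_t \sum_(j < N.+1) ((\1_D t * pois mu (N - j) (Y t))%:E * K j))%E.
  apply: eq_integral => t _; rewrite /h /=.
  under eq_integral do rewrite EFinM.
  rewrite ge0_integralZl//=.
  - rewrite integral_erlang_overshoot// ge0_sume_distrr.
      by apply: eq_bigr => j _; rewrite muleA.
    move=> j _; apply: mule_ge0; last exact: K0.
    by rewrite lee_fin; apply: pois_ge0 => //; exact: ltW.
  - apply/measurable_EFinP; apply: measurableT_comp => //; exact: measurable_funB.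
  - by move=> x _; rewrite lee_fin.
rewrite ge0_integral_sum//.
- apply: eq_bigr => j _; rewrite ge0_integralZr//.
  + exact/measurable_EFinP.
  + by move=> t _; rewrite lee_fin.
- move=> j; apply: emeasurable_funM => //; exact/measurable_EFinP.
- by move=> j t _; rewrite mule_ge0// lee_fin.
Qed.

End independent_erlang.

(** * The alternating Lindley recursion *)

(** [mxpow] multiplies on the left, whereas a row of phase weights evolves by multiplication on the
    right. *)
Lemma mxpowSr (R : realType) (N : nat) (M : 'M[R]_N) k :
  mxpow M k.+1 = mxpow M k *m M.
Proof.
rewrite /mxpow; elim: k => [|k IH]; first by rewrite /= mulmx1 mul1mx.
by rewrite [LHS]iterS [in LHS]IH mulmxA.
Qed.

(** By [poisM] this is a Gamma integral of rate [2 * mu]. The value is a negative binomial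
    probability: [l] points of one process precede the [j.+1]-st point of an independent one of
    equal rate. *)
Lemma integral_pois_erlang_pdf {R : realType} (mu : R) (l j : nat) : 0 < mu ->
  (\int[lebesgue_measure]_(x in `]0%R, +oo[) (pois mu l x * erlang_pdf j.+1 mu x)%:E =
   ('C(j + l, j)%:R / 2 ^+ (j + l).+1)%:E)%E.
Proof.
move=> mu0; have mu20 : 0 < 2 * mu by rewrite mulr_gt0.
pose c : R := mu * ('C(j + l, j)%:R / 2 ^+ (j + l)).
have c0 : 0 <= c by rewrite mulr_ge0 ?(ltW mu0)// divr_ge0// exprn_ge0.
transitivity (\int[lebesgue_measure]_(x in `]0%R, +oo[) (c%:E * (pois (2 * mu) (j + l) x)%:E))%E.
  apply: eq_integral => x _; rewrite -EFinM; congr _%:E.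
  by rewrite erlang_pdf_pois mulrCA (mulrC (pois mu l x)) poisM mulrA.
rewrite ge0_integralZl//=.
- rewrite integral_pois// -EFinM; congr _%:E; rewrite /c exprS; field.
  by rewrite expf_neq0// gt_eqF.
- by apply/measurable_EFinP/measurable_funTS; exact: measurable_pois.
- move=> x; rewrite in_itv /= andbT => x0.
  by rewrite lee_fin; apply: pois_ge0; exact: ltW.
Qed.

Definition pos_index (i : nat + nat) : Prop :=
  match i with inl n => (1 <= n)%N | inr n => (1 <= n)%N end.

Section lindley.
Context d (T : measurableType d) (R : realType) (P : probability T R).
Context (A B : nat -> {RV P >-> R}) (N : nat) (mu : R).
Hypothesis mu0 : 0 < mu.
Hypothesis A0 : forall n t, (1 <= n)%N -> 0 <= A n t.
Hypothesis lawA : forall n E, (1 <= n)%N -> measurable E ->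
  P (A n @^-1` E) = P (A 1%N @^-1` E).
Hypothesis erlangB : forall n, (1 <= n)%N -> erlang_distributed P N.+1 mu (B n).
Hypothesis indepAB : mutually_independent P
  pos_index
  (fun i => match i with inl n => (A n : T -> R) | inr n => (B n : T -> R) end).

Local Notation V := (W (fun k => A k : T -> R) (fun k => B k : T -> R)).
Local Notation alpha := (lst P (A 1%N)).
Local Notation Q := (Qmx alpha N.+1 mu).

(** * Measurability with respect to the past, and independence from it *)

Let X (i : nat + nat) : T -> R :=
  match i with inl n => (A n : T -> R) | inr n => (B n : T -> R) end.

(** Two bounds are kept because the recursion alternates: A_(n+1) must be independent of
    [past n n.+1], and B_(n+2) of [past n.+1 n.+1]. *)
Definition past (a b : nat) : seq (nat + nat) :=
  [seq inl n | n <- iota 1 a] ++ [seq inr n | n <- iota 1 b].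

Let cyl a b := cylinders X (mem (past a b)).
Local Notation TG a b := (g_sigma_algebraType (cyl a b)).

Lemma mem_past_l a b n : (inl n \in past a b) = (1 <= n <= a)%N.
Proof.
rewrite mem_cat mem_map; last by move=> ? ? [].
rewrite mem_iota add1n ltnS [X in _ || X](_ : _ = false) ?orbF//.
by apply/negbTE/mapP => -[].
Qed.

Lemma mem_past_r a b n : (inr n \in past a b) = (1 <= n <= b)%N.
Proof.
rewrite mem_cat [in X in _ || X]mem_map; last by move=> ? ? [].
rewrite mem_iota add1n ltnS [X in X || _](_ : _ = false)//.
by apply/negbTE/mapP => -[].
Qed.

Lemma past_uniq a b : uniq (past a b).
Proof.
rewrite cat_uniq !map_inj_uniq ?iota_uniq; [|by move=> ? ? []|by move=> ? ? []].
by rewrite andbT /=; apply/hasPn => _ /mapP[n _ ->]; apply/negP => /mapP[].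
Qed.

Let past_pos a b i : i \in past a b -> pos_index i.
Proof. by case: i => n; rewrite ?mem_past_l ?mem_past_r => /andP[]. Qed.

Let mX i : measurable_fun setT (X i).
Proof. by case: i => n; exact: measurable_funP. Qed.

Let cyl_measurable a b : cyl a b `<=` measurable.
Proof. by apply: (cylinders_measurable (fun i _ => mX i)); exact: past_pos. Qed.

Let indep_future a b (Z : {RV P >-> R}) i : (Z : T -> R) = X i ->
  pos_index i -> i \notin past a b ->
  forall S F, <<s cyl a b >> S -> measurable F ->
  (P (S `&` Z @^-1` F) = P S * P (Z @^-1` F))%E.
Proof.
move=> -> Di iJ S F GS mF.
exact: (sigma_cylinders_indep indepAB (fun i _ => mX i) (past_uniq a b) (@past_pos a b) Di iJ GS mF).
Qed.

Let measurable_coord a b i : i \in past a b -> measurable_fun (setT : set (TG a b)) (X i).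
Proof.
move=> iJ _ F mF; rewrite setTI; apply: sub_sigma_algebra.
exact: cylinders_preimage.
Qed.

Lemma W_ge0 n t : 0 <= V n t.
Proof. by case: n => [|[|n]] //=; rewrite le_max lexx. Qed.

Let measurable_W a b n : (n <= a)%N -> (n < b)%N ->
  measurable_fun (setT : set (TG a b)) (V n.+1).
Proof.
elim: n => [|n IH] na nb; first exact: measurable_cst.
apply: measurable_maxr; first exact: measurable_cst.
apply: measurable_funB; last by apply: IH; [exact: ltnW|exact: ltnW].
apply: measurable_funB.
  by apply: (measurable_coord (i := inr n.+2)); rewrite mem_past_r.
by apply: (measurable_coord (i := inl n.+1)); rewrite mem_past_l.
Qed.

(** * The events C > n *)

(* The event [C > n]. *)
Fixpoint busy (n : nat) : set T :=
  if n is m.+1 then busy m `&` [set t | 0 < V n.+1 t] else setT.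

Lemma busyP n t : busy n t <-> forall k, (1 <= k < n.+1)%N -> V k.+1 t <> 0.
Proof.
elim: n => [|n IH]; first by split => // _ [|k].
split => [[/IH H V0] k /andP[k1]|H].
  rewrite ltnS leq_eqVlt => /predU1P[->|kn]; last by apply: H; rewrite k1.
  by apply/eqP; rewrite gt_eqF.
split; first by apply/IH => k /andP[k1 kn]; apply: H; rewrite k1 ltnW.
change (0 < V n.+2 t); rewrite lt_neqAle W_ge0 andbT eq_sym.
by apply/eqP; apply: H; rewrite ltnS leqnn.
Qed.

Lemma C_eq_busy n :
  C_eq (fun k => A k : T -> R) (fun k => B k : T -> R) n.+1 = busy n `\` busy n.+1.
Proof.
apply/seteqP; split => t.
  move=> [_ [V0 H]]; split; first exact/busyP.
  by move=> [_]; change (~ (0 < V n.+2 t)); rewrite V0 ltxx.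
move=> [bn nb]; split => //; split; last exact/busyP.
apply/eqP; rewrite eq_le W_ge0 andbT leNgt; apply/negP => V0.
by apply: nb; split.
Qed.

Let sigma_busy a b n : (n <= a)%N -> (n < b)%N -> <<s cyl a b >> (busy n).
Proof.
elim: n => [|n IH] na nb; first exact: (@measurableT _ (TG a b)).
apply: (@measurableI _ (TG a b)); first by apply: IH; exact: ltnW.
have := measurable_W na nb; move=> /(_ measurableT `]0, +oo[%classic (measurable_itv _)).
rewrite setTI; congr (<<s _ >> _); apply/seteqP.
by split => t /=; rewrite in_itv /= andbT.
Qed.

Lemma measurable_busy n : measurable (busy n).
Proof. by apply: (sigma_sub_measurable (@cyl_measurable n n.+1)); exact: sigma_busy. Qed.

(** * One step of the recursion *)

Let measurable_abs_pois k : measurable_fun setT (fun x => `|pois mu k x|).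
Proof. by apply: measurableT_comp => //; exact: measurable_pois. Qed.

(** Poisson weights may be negative at negative arguments, while the integration lemmas ask for test
    functions nonnegative on the whole line. The absolute value changes nothing at values of A or
    W. *)
Let abs_pois k x : 0 <= x -> `|pois mu k x| = pois mu k x.
Proof. by move=> x0; rewrite ger0_norm// pois_ge0// ltW. Qed.

Let a k : R := (- mu) ^+ k / k`!%:R * nderiv k alpha mu.

Lemma integral_pois_A n k : (1 <= n)%N -> (\int[P]_t (pois mu k (A n t))%:E = (a k)%:E)%E.
Proof.
move=> n1; rewrite /a -integral_pois_lst//; last by move=> t; exact: A0.
have E m : (1 <= m)%N -> (\int[P]_t (pois mu k (A m t))%:E =
    \int[distribution P (A m)]_x `|pois mu k x|%:E)%E.
  move=> m1; rewrite ge0_integral_distribution; last by move=> y; rewrite lee_fin.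
    by apply: eq_integral => t _ /=; rewrite abs_pois// A0.
  exact/measurable_EFinP.
by rewrite !E//; apply: eq_measure_integral => S mS _; exact: lawA.
Qed.

(** [poisD] separates A_(n+1) from W_(n+1); the former is independent of the past that determines
    W_(n+1) and [busy n]. *)
Lemma busy_pois_convolution n m :
  (\int[P]_t (\1_(busy n) t * pois mu m (A n.+1 t + V n.+1 t))%:E =
   \sum_(l < m.+1) \int[P]_t (\1_(busy n) t * pois mu l (V n.+1 t))%:E * (a (m - l))%:E)%E.
Proof.
have mb : measurable_fun (setT : set (TG n n.+1)) (\1_(busy n) : TG n n.+1 -> R).
  by apply: (@measurable_indic _ (TG n n.+1)); exact: sigma_busy.
pose u l (t : T) : R := \1_(busy n) t * pois mu l (V n.+1 t).
have mu_ l : measurable_fun (setT : set (TG n n.+1)) (u l).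
  apply: measurable_funM => //; apply: measurableT_comp; first exact: measurable_pois.
  exact: measurable_W.
have u0 l t : 0 <= u l t.
  by rewrite mulr_ge0// pois_ge0 ?W_ge0// ltW.
transitivity (\int[P]_t \sum_(l < m.+1) (u l t * `|pois mu (m - l) (A n.+1 t)|)%:E)%E.
  apply: eq_integral => t _; rewrite poisD mulr_sumr sumEFin; congr _%:E.
  by apply: eq_bigr => l _; rewrite abs_pois ?A0// /u mulrA mulrAC.
rewrite ge0_integral_sum//; last 2 first.
- move=> l; apply/measurable_EFinP/measurable_funM.
    exact: (measurable_fun_sigma_sub (@cyl_measurable n n.+1)).
  exact: (measurableT_comp (measurable_abs_pois _)).
- by move=> l t _; rewrite lee_fin mulr_ge0.
apply: eq_bigr => l _.
have nin : inl n.+1 \notin past n n.+1 by rewrite mem_past_l ltnn andbF.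
have ind := @indep_future n n.+1 (A n.+1) (inl n.+1) erefl isT nin.
rewrite (ge0_integral_indepM (@cyl_measurable n n.+1) ind (mu_ l) (u0 l) (measurable_abs_pois (m - l))) //.
congr (_ * _)%E; rewrite -(integral_pois_A _ (isT : 1 <= n.+1)%N).
by apply: eq_integral => t _; rewrite abs_pois// A0.
Qed.

Lemma busy_step n (f : R -> R) : measurable_fun setT f -> (forall x, 0 <= f x) ->
  (\int[P]_t (\1_(busy n.+1) t * f (V n.+2 t))%:E =
   \sum_(j < N.+1)
     \int[P]_t (\1_(busy n) t * pois mu (N - j) (A n.+1 t + V n.+1 t)%R)%:E *
     \int[lebesgue_measure]_(x in `]0%R, +oo[) (f x * erlang_pdf j.+1 mu x)%:E)%E.
Proof.
move=> mf f0.
have nin : inr n.+2 \notin past n.+1 n.+1 by rewrite mem_past_r ltnn andbF.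
have ind := @indep_future n.+1 n.+1 (B n.+2) (inr n.+2) erefl isT nin.
rewrite -(integral_erlang_overshoot_indep (@cyl_measurable n.+1 n.+1) ind mu0
  (erlangB (isT : 1 <= n.+2)%N) (Y := fun t => A n.+1 t + V n.+1 t)) //.
- apply: eq_integral => t _; congr _%:E.
  have VE : V n.+2 t = Num.max 0 (B n.+2 t - (A n.+1 t + V n.+1 t)).
    by rewrite opprD addrA.
  pose D := busy n `&` [set t | 0 < B n.+2 t - (A n.+1 t + V n.+1 t)].
  (* On C > n, a positive W_(n+2) is exactly the overshoot of B_(n+2) above A_(n+1) + W_(n+1). *)
  rewrite (_ : busy n.+1 = D) -/D.
    have [[_ /ltW B0]|Dt] := pselect (D t); first by rewrite VE max_r.
    by rewrite indicE memNset// !mul0r.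
  have subAV s : B n.+2 s - (A n.+1 s + V n.+1 s) = B n.+2 s - A n.+1 s - V n.+1 s.
    by rewrite opprD addrA.
  apply/seteqP; split => s [bs V0]; split => //; move: V0 => /=.
    by rewrite subAV lt_max ltxx.
  by rewrite subAV lt_max => ->; rewrite orbT.
- by apply: sigma_busy.
- apply: measurable_funD; last by apply: measurable_W.
  by apply: (measurable_coord (i := inl n.+1)); rewrite mem_past_l /=.
- by move=> t; rewrite addr_ge0 ?A0 ?W_ge0.
Qed.

(** * Propagation of the phase weights *)

(* Entry [j] is the probability of [C > n.+1] and [F_(n+2) = j.+1]. *)
Definition phase_weights (n : nat) : 'rV[R]_N.+1 := qrow alpha N.+1 mu *m mxpow Q n.

Lemma phase_weights_p0j j :
  (a (N - j) : R) = p_0j alpha N.+1 mu j.+1.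
Proof. by rewrite /a /p_0j subSS. Qed.

(** Of the [N - j] phases of B that elapse during A + W, [l] fall in W, which has [i.+1] phases, and
    the others in A. *)
Lemma phase_transition (i j : nat) :
  \sum_(l < (N - j).+1) 'C(i + l, i)%:R / 2 ^+ (i + l).+1 * a (N - j - l) =
  p_ij alpha N.+1 mu i.+1 j.+1.
Proof.
rewrite /p_ij subSS mulr_sumr; apply: eq_bigr => l _.
rewrite addSn !subSS !subn0 /a.
have ml : (l <= N - j)%N by rewrite -ltnS.
have -> : (- mu) ^+ (N - j) = (- mu) ^+ (N - j - l) * (- mu) ^+ l.
  by rewrite -exprD subnK.
have -> : (- (2 * mu)^-1) ^+ l = ((- mu) ^+ l)^-1 / 2 ^+ l.
  by rewrite -invrN -mulrN invfM exprMn !exprVn mulrC.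
rewrite exprS exprD exprS; field.
by rewrite factr_neq0 !expf_neq0// oppr_eq0 gt_eqF.
Qed.

Lemma busy_invariant n (f : R -> R) : measurable_fun setT f -> (forall x, 0 <= f x) ->
  (\int[P]_t (\1_(busy n.+1) t * f (V n.+2 t))%:E =
   \sum_(j < N.+1) (phase_weights n 0 j)%:E *
     \int[lebesgue_measure]_(x in `]0%R, +oo[) (f x * erlang_pdf j.+1 mu x)%:E)%E.
Proof.
elim: n f => [|n IH] f mf f0; rewrite busy_step//; apply: eq_bigr => j _;
  rewrite busy_pois_convolution; congr (_ * _)%E.
  (* Base case: W_1 = 0, so only the weight with [l = 0] survives, and it equals 1. *)
  rewrite big_ord_recl big1 => [|l _].
    rewrite subn0 adde0 /phase_weights mulmx1 mxE -phase_weights_p0j -[RHS]mul1e.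
    congr (_ * _)%E; rewrite -(@probability_setT _ _ _ P) -[RHS]mul1e -integral_cst//.
    by apply: eq_integral => t _; rewrite indicT pois0 mul1r.
  rewrite integral0_eq ?mul0e// => t _.
  by rewrite indicT pois0 mulr0.
transitivity (\sum_(l < (N - j).+1)
    ((\sum_(i < N.+1) phase_weights n 0 i * ('C(i + l, i)%:R / 2 ^+ (i + l).+1)) *
     a (N - j - l))%:E)%E.
  apply: eq_bigr => l _; rewrite [RHS]EFinM; congr (_ * _)%E.
  (* The induction hypothesis is used with a Poisson weight as test function, which is why the
     invariant quantifies over [f]. *)
  transitivity (\int[P]_t (\1_(busy n.+1) t * `|pois mu l (V n.+2 t)|)%:E)%E.
    by apply: eq_integral => t _; rewrite abs_pois// W_ge0.
  rewrite (IH (fun x => `|pois mu l x|))// -sumEFin; apply: eq_bigr => i _.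
  rewrite [RHS]EFinM -(integral_pois_erlang_pdf l i mu0); congr (_ * _)%E.
  apply: eq_integral => x; rewrite inE /= in_itv /= andbT => x0.
  by rewrite abs_pois// ltW.
rewrite sumEFin; congr _%:E.
rewrite /phase_weights mxpowSr mulmxA -/(phase_weights n) mxE.
under eq_bigr do rewrite mulr_suml.
rewrite exchange_big; apply: eq_bigr => i _; rewrite [Q i j]mxE -phase_transition mulr_sumr.
by apply: eq_bigr => l _; rewrite -mulrA.
Qed.

(** Take [f = 1] in the invariant; each Erlang density has integral 1. *)
Lemma prob_busy n :
  P (busy n.+1) = ((phase_weights n *m (const_mx 1 : 'cV[R]_N.+1)) 0 0)%:E.
Proof.
transitivity (\int[P]_t (\1_(busy n.+1) t * cst 1 (V n.+2 t))%:E)%E.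
  under eq_integral do rewrite mulr1.
  by rewrite integral_indic ?setIT//; exact: measurable_busy.
rewrite busy_invariant// mxE -sumEFin; apply: eq_bigr => j _.
rewrite [const_mx _ _ _]mxE mulr1 -[RHS]mule1; congr (_ * _)%E.
transitivity (\int[lebesgue_measure]_(x in `]0%R, +oo[) (mu%:E * (pois mu j x)%:E))%E.
  by apply: eq_integral => x _; rewrite mul1r erlang_pdf_pois.
rewrite ge0_integralZl//=.
- by rewrite integral_pois// -EFinM divff// gt_eqF.
- by apply/measurable_EFinP/measurable_funTS; exact: measurable_pois.
- move=> x; rewrite in_itv /= andbT => x0.
  by rewrite lee_fin; apply: pois_ge0; exact: ltW.
- by rewrite lee_fin ltW.
Qed.

Lemma prob_C_eq n :
  P (C_eq (fun k => A k : T -> R) (fun k => B k : T -> R) n.+2) =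
  ((phase_weights n *m (1%:M - Q) *m (const_mx 1 : 'cV[R]_N.+1)) 0 0)%:E.
Proof.
have busyS : busy n.+1 `&` busy n.+2 = busy n.+2 by apply: setIidr => t [].
transitivity (P (busy n.+1) - P (busy n.+2))%E.
  rewrite C_eq_busy -[in RHS]busyS; apply: measureD; try exact: measurable_busy.
  by rewrite (le_lt_trans (probability_le1 P (measurable_busy _))) ?ltry.
rewrite !prob_busy -EFinB; congr _%:E.
rewrite mulmxBr mulmx1 mulmxBl [in RHS]mxE [in X in _ = _ + X]mxE.
by rewrite {2}/phase_weights mxpowSr mulmxA.
Qed.

End lindley.

Theorem theorem5p2 (d : measure_display) (T : measurableType d) (R : realType)
  (P : probability T R) (A B : nat -> {RV P >-> R}) (N : nat) (mu : R) :
  (0 < N)%N -> 0 < mu ->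
  (forall n t, (1 <= n)%N -> 0 <= A n t) ->
  (forall n E, (1 <= n)%N -> measurable E -> P (A n @^-1` E) = P (A 1%N @^-1` E)) ->
  (forall n, (1 <= n)%N -> erlang_distributed P N mu (B n)) ->
  mutually_independent P (fun i : nat + nat => match i with inl n => (1 <= n)%N | inr n => (1 <= n)%N end)
    (fun i => match i with inl n => (A n : T -> R) | inr n => (B n : T -> R) end) ->
  let alpha := lst P (A 1%N) in
  forall n : nat, (1 <= n)%N ->
    P (C_eq (fun k => A k : T -> R) (fun k => B k : T -> R) n.+1) =
    ((qrow alpha N mu *m mxpow (Qmx alpha N mu) n.-1 *m (1%:M - Qmx alpha N mu)
        *m (const_mx 1 : 'cV[R]_N)) 0 0)%:E.
Proof.
(* Positive [N] and [n] are written as successors, so that [n.-1] becomes the exponent in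
   [phase_weights]. *)
case: N => // N _ mu0 A0 lawA erlangB indepAB alpha [//|n] _.
exact: prob_C_eq mu0 A0 lawA erlangB indepAB n.
Qed.
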